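(* Let $G$ be an affine game. Then: $G>0$ if and only if $G\in\mathcal L$; $G=0$ if and only if $G\in\mathcal P$; $G\,\|\,0$ if and only if $G\in\mathcal N$; $G<0$ if and only if $G\in\mathcal R$.
   Context: Affine games are defined recursively. There are two games without options, denoted $\infty$ and $\overline{\infty}$ (terminating games). Every other affine game is a form $G=\{G^{\mathcal L}\mid G^{\mathcal R}\}$, where $G^{\mathcal L}$ (Left options) and $G^{\mathcal R}$ (Right options) are non-empty finite sets of previously constructed affine games. Let $\mathbb A$ be the set of all affine games. The game $0$ is $\{\overline\infty\mid\infty\}$. Disjunctive sum: $G+H$ is undefined if one of $G,H$ is the form $\infty$ and the other is $\overline\infty$; it is $\infty$ if one is $\infty$ and the other is not $\overline\infty$; it is $\overline\infty$ if one is $\overline\infty$ and the other is not $\infty$; otherwise $G+H=\{G^{\mathcal L}+H,\,G+H^{\mathcal L}\mid G^{\mathcal R}+H,\,G+H^{\mathcal R}\}$. Outcomes: $o^L(G)=\mathbf L$ if $G=\infty$ or some $G^L\in G^{\mathcal L}$ has $o^R(G^L)=\mathbf L$, and $o^L(G)=\mathbf R$ otherwise; $o^R(G)=\mathbf R$ if $G=\overline\infty$ or some $G^R\in G^{\mathcal R}$ has $o^L(G^R)=\mathbf R$, and $o^R(G)=\mathbf L$ otherwise. With $\mathbf L>\mathbf R$, the outcome is $o(G)=(o^L(G),o^R(G))$, ordered componentwise. $\mathcal L,\mathcal N,\mathcal P,\mathcal R$ are the classes of games with outcome $(\mathbf L,\mathbf L)$, $(\mathbf L,\mathbf R)$, $(\mathbf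 R,\mathbf L)$, $(\mathbf R,\mathbf R)$, respectively. Order and equality: $G\geqslant H$ iff $o(G+X)\geqslant o(H+X)$ for all $X\in\mathbb A\setminus\{\infty,\overline\infty\}$; $G=H$ (equality of games, not identity of forms) iff $o(G+X)=o(H+X)$ for all such $X$; $G>H$ means $G\geqslant H$ and $G\neq H$; $G<H$ means $H>G$; $G\,\|\,H$ means neither $G\geqslant H$ nor $H\geqslant G$. *)

(* Defs.v *)
From mathcomp Require Import all_boot all_order.

Set Implicit Arguments.
Unset Strict Implicit.
Unset Printing Implicit Defensive.

Import Order.Theory.

(* [Inf] and [MInf] are the terminating games [oo] and [oo-bar].  A non-empty
   finite set of options is presented as a family indexed by ['I_m.+1];
   repetitions and ordering of the options are irrelevant to every notion
   below. *)
Inductive game : Type :=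
| Inf
| MInf
| Form (m n : nat) (GL : 'I_m.+1 -> game) (GR : 'I_n.+1 -> game).

Definition zero : game :=
  Form (fun _ : 'I_1 => MInf) (fun _ : 'I_1 => Inf).

Definition terminating (G : game) : bool :=
  if G is Form _ _ _ _ then false else true.

Definition sum_defined (G H : game) : bool :=
  match G, H with
  | Inf, MInf | MInf, Inf => false
  | _, _ => true
  end.

(* The values at [(Inf, MInf)] and [(MInf, Inf)] are junk: they are discarded
   by [gadd], and the recursion starting from a defined sum never reaches them
   (see [sum_defined_options]). *)
Fixpoint sum_total (G : game) : game -> game :=
  fix sum_totalG (H : game) : game :=
    match G, H with
    | Inf, _ => Inf
    | MInf, _ => MInf
    | Form _ _ _ _, Inf => Inf
    | Form _ _ _ _, MInf => MInf
    | Form m n GL GR, Form p q HL HR =>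
        Form (m := m + p.+1) (n := n + q.+1)
          (fun k : 'I_(m.+1 + p.+1) =>
             match split k with
             | inl i => sum_total (GL i) H
             | inr j => sum_totalG (HL j)
             end)
          (fun k : 'I_(n.+1 + q.+1) =>
             match split k with
             | inl i => sum_total (GR i) H
             | inr j => sum_totalG (HR j)
             end)
    end.

Definition gadd (G H : game) : option game :=
  if sum_defined G H then Some (sum_total G H) else None.

Lemma sum_definedP (G X : game) : ~~ terminating X -> gadd G X <> None.
Proof. by case: G => [||m n GL GR]; case: X. Qed.

Lemma sum_defined_options m n (GL : 'I_m.+1 -> game) (GR : 'I_n.+1 -> game)
    p q (HL : 'I_p.+1 -> game) (HR : 'I_q.+1 -> game) :
  [/\ forall i, sum_defined (GL i) (Form HL HR),
      forall j, sum_defined (Form GL GR) (HL j),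
      forall i, sum_defined (GR i) (Form HL HR)
    & forall j, sum_defined (Form GL GR) (HR j)].
Proof. by split=> // i; [case: (GL i) | case: (GR i)]. Qed.

(* A result is a boolean: [true] stands for L (Left wins), [false] for R, so
   that the library's order [false < true] is the convention L > R. *)
Fixpoint outcomeL (G : game) : bool :=
  match G with
  | Inf => true
  | MInf => false
  | Form m n GL GR => [exists i, outcomeR (GL i) == true]
  end
with outcomeR (G : game) : bool :=
  match G with
  | Inf => true
  | MInf => false
  | Form m n GL GR => ~~ [exists j, outcomeL (GR j) == false]
  end.

(* [*p] carries the componentwise order. *)
Definition outcome (G : game) : (bool *p bool)%type :=
  (outcomeL G, outcomeR G).

Definition in_L (G : game) : Prop := outcome G = (true, true).
Definition in_N (G : game) : Prop := outcome G = (true, false).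
Definition in_P (G : game) : Prop := outcome G = (false, true).
Definition in_R (G : game) : Prop := outcome G = (false, false).

(* Both sums exist because [X] is not terminating ([sum_definedP]), so
   quantifying over their values is the same as evaluating them. *)
Definition game_ge (G H : game) : Prop :=
  forall X GX HX : game, ~~ terminating X ->
    gadd G X = Some GX -> gadd H X = Some HX ->
    (outcome GX >= outcome HX)%O.

Definition game_eq (G H : game) : Prop :=
  forall X GX HX : game, ~~ terminating X ->
    gadd G X = Some GX -> gadd H X = Some HX ->
    outcome GX = outcome HX.

Definition game_gt (G H : game) : Prop := game_ge G H /\ ~ game_eq G H.
Definition game_lt (G H : game) : Prop := game_gt H G.
Definition game_fuzzy (G H : game) : Prop := ~ game_ge G H /\ ~ game_ge H G.

(* Main.v *)
Require Import Defs.
From Stdlib Require Import Setoid.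
From mathcomp Require Import all_boot all_order.

(** [G >= 0] holds exactly when Left wins [G] moving second. Testing against
    [X = 0] gives one direction, since adding [0] never changes an outcome (its
    options lose at once for the player moving there). Conversely, a Left win
    moving second in [G] combines with a win in [X] by answering each Right move
    in the summand where it was made. Dually, [0 >= G] holds exactly when Right
    wins [G] moving second; the four cases combine these two facts. *)

Lemma outcomeL_Form m n (GL : 'I_m.+1 -> game) (GR : 'I_n.+1 -> game) :
  outcomeL (Form GL GR) = [exists i, outcomeR (GL i)].
Proof. by apply: eq_existsb => i; rewrite eqb_id. Qed.

Lemma outcomeR_Form m n (GL : 'I_m.+1 -> game) (GR : 'I_n.+1 -> game) :
  outcomeR (Form GL GR) = [forall j, outcomeL (GR j)].
Proof.
by rewrite /= negb_exists; apply: eq_forallb => j; rewrite eqbF_neg negbK.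
Qed.

(** Options of a sum are indexed through [split]; this separates a move in the first summand from a
    move in the second. *)
Lemma exists_split m p (P : pred ('I_m + 'I_p)) :
  [exists k : 'I_(m + p), P (split k)] =
  [exists i, P (inl i)] || [exists j, P (inr j)].
Proof.
apply/existsP/orP => [[k]|[] /existsP[i Pi]].
- by case: (split k) => i Pi; [left | right]; apply/existsP; exists i.
- by exists (unsplit (inl i)); rewrite unsplitK.
- by exists (unsplit (inr i)); rewrite unsplitK.
Qed.

Lemma forall_split m p (P : pred ('I_m + 'I_p)) :
  [forall k : 'I_(m + p), P (split k)] =
  [forall i, P (inl i)] && [forall j, P (inr j)].
Proof.
apply: negb_inj; rewrite negb_and !negb_forall.
exact: (exists_split _ _ (predC P)).
Qed.

Section SumOutcomes.

Context {m n p q : nat}.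
Variables (GL : 'I_m.+1 -> game) (GR : 'I_n.+1 -> game).
Variables (HL : 'I_p.+1 -> game) (HR : 'I_q.+1 -> game).
Let G := Form GL GR.
Let H := Form HL HR.

Lemma outcomeL_sum :
  outcomeL (sum_total G H) =
  [exists i, outcomeR (sum_total (GL i) H)] ||
  [exists j, outcomeR (sum_total G (HL j))].
Proof.
rewrite [sum_total G H]/= outcomeL_Form.
(* [P] exposes the options as a predicate of [split k]; the two sides then agree by conversion. *)
pose P (u : 'I_m.+1 + 'I_p.+1) := outcomeR
  match u with inl i => sum_total (GL i) H | inr j => sum_total G (HL j) end.
exact: (exists_split _ _ P).
Qed.

Lemma outcomeR_sum :
  outcomeR (sum_total G H) =
  [forall i, outcomeL (sum_total (GR i) H)] &&
  [forall j, outcomeL (sum_total G (HR j))].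
Proof.
rewrite [sum_total G H]/= outcomeR_Form.
pose P (u : 'I_n.+1 + 'I_q.+1) := outcomeL
  match u with inl i => sum_total (GR i) H | inr j => sum_total G (HR j) end.
exact: (forall_split _ _ P).
Qed.

End SumOutcomes.

Lemma outcome_add0 X : outcome (sum_total zero X) = outcome X.
Proof.
elim: X => // p q HL IHL HR IHR.
rewrite /outcome /zero outcomeL_sum outcomeR_sum outcomeL_Form outcomeR_Form.
congr (_, _).
  (* Left's move in [zero] collapses the sum to [MInf], a loss, so only moves in [X] remain. *)
  rewrite (_ : [exists i, _] = false) ?orFb; last by apply/existsP => -[].
  by apply: eq_existsb => j; case: (IHL j).
rewrite (_ : [forall i, _] = true) ?andTb; last by apply/forallP.
by apply: eq_forallb => j; case: (IHR j).
Qed.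

(** The clauses feed each other: a Right move turns the first into the second or third at an option,
    and Left's reply in that summand returns to the first. Hence the joint nested induction. The
    junk pairs of [Inf] and [MInf] satisfy none of the premises. Clauses one and three say that
    adding [G] never hurts Left. *)
Lemma sum_total_Left_wins G X :
  [/\ outcomeR G -> outcomeR X -> outcomeR (sum_total G X),
      outcomeL G -> outcomeR X -> outcomeL (sum_total G X)
    & outcomeR G -> outcomeL X -> outcomeL (sum_total G X)].
Proof.
elim: G X => [||m n GL IGL GR IGR]; [by case | by case |].
elim=> [||p q HL IHL HR IHR]; [by [] | by split=> //= _ | split].
(* Whichever summand Right moves in, Left now wins it moving first and still wins the other moving
   second. *)
- move=> GR_L XR_L; rewrite outcomeR_sum; apply/andP; split; apply/forallP => j.
    case: (IGR j (Form HL HR)) => _ + _; apply=> //.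
    by move: GR_L; rewrite outcomeR_Form => /forallP.
  case: (IHR j) => _ _; apply=> //.
  by move: XR_L; rewrite outcomeR_Form => /forallP.
- rewrite outcomeL_Form => /existsP[i Gi] XR_L.
  rewrite outcomeL_sum; apply/orP; left; apply/existsP; exists i.
  by case: (IGL i (Form HL HR)) => + _ _; apply.
- move=> GR_L; rewrite outcomeL_Form => /existsP[i Xi].
  rewrite outcomeL_sum; apply/orP; right; apply/existsP; exists i.
  by case: (IHL i) => + _ _; apply.
Qed.

(** The same strategy with the players exchanged. It is not a contrapositive of the Left version,
    since Right must now win in both summands. *)
Lemma sum_total_Right_wins G X :
  [/\ ~~ outcomeL G -> ~~ outcomeL X -> ~~ outcomeL (sum_total G X),
      ~~ outcomeR G -> ~~ outcomeL X -> ~~ outcomeR (sum_total G X)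
    & ~~ outcomeL G -> ~~ outcomeR X -> ~~ outcomeR (sum_total G X)].
Proof.
elim: G X => [||m n GL IGL GR IGR]; [by case | by case |].
elim=> [||p q HL IHL HR IHR]; [by split=> //= _ | by [] | split].
- move=> GL_R XL_R; rewrite outcomeL_sum negb_or !negb_exists.
  apply/andP; split; apply/forallP => j.
    case: (IGL j (Form HL HR)) => _ + _; apply=> //.
    by move: GL_R; rewrite outcomeL_Form negb_exists => /forallP.
  case: (IHL j) => _ _; apply=> //.
  by move: XL_R; rewrite outcomeL_Form negb_exists => /forallP.
- rewrite outcomeR_Form negb_forall => /existsP[i Gi] XL_R.
  rewrite outcomeR_sum negb_and !negb_forall.
  apply/orP; left; apply/existsP; exists i.
  by case: (IGR i (Form HL HR)) => + _ _; apply.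
- move=> GL_R; rewrite outcomeR_Form negb_forall => /existsP[i Xi].
  rewrite outcomeR_sum negb_and !negb_forall.
  apply/orP; right; apply/existsP; exists i.
  by case: (IHR i) => + _ _; apply.
Qed.

Lemma gaddE G X : ~~ terminating X -> gadd G X = Some (sum_total G X).
Proof. by case: X G => // p q HL HR []. Qed.

Lemma outcomeL_zero : outcomeL zero = false.
Proof. by rewrite outcomeL_Form; apply/existsP => -[]. Qed.

Lemma outcomeR_zero : outcomeR zero = true.
Proof. by rewrite outcomeR_Form; apply/forallP. Qed.

(** In [zero] whoever moves first loses, so each player's win in [G] carries over to the sum; no
    commutativity of the sum is involved. *)
Lemma outcome_addr0 G : outcome (sum_total G zero) = outcome G.
Proof.
have [LR LL _] := sum_total_Left_wins G zero.
have [RL RR _] := sum_total_Right_wins G zero.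
have zL : ~~ outcomeL zero by rewrite outcomeL_zero.
have zR : outcomeR zero by rewrite outcomeR_zero.
rewrite /outcome; congr (_, _); apply/idP/idP.
- by apply: contraTT => /RL; apply.
- by move=> /LL; apply.
- by apply: contraTT => /RR; apply.
- by move=> /LR; apply.
Qed.

Lemma outcome_leE G H :
  (outcome G <= outcome H)%O =
  (outcomeL G ==> outcomeL H) && (outcomeR G ==> outcomeR H).
Proof.
rewrite /outcome.
by case: (outcomeL G) (outcomeL H) (outcomeR G) (outcomeR H) => [] [] [] [].
Qed.

Lemma game_ge0 G : game_ge G zero <-> outcomeR G.
Proof.
split=> [ge0|GR_L X GX ZX tX].
  have := ge0 zero _ _ isT (gaddE _ zero isT) (gaddE _ zero isT).
  by rewrite !outcome_addr0 outcome_leE outcomeL_zero outcomeR_zero.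
rewrite !gaddE // => -[<-] [<-]; rewrite outcome_add0 outcome_leE.
have [LR _ LL] := sum_total_Left_wins G X.
by apply/andP; split; apply/implyP; [apply: LL | apply: LR].
Qed.

Lemma game_le0 G : game_ge zero G <-> ~~ outcomeL G.
Proof.
split=> [ge0|GL_R X ZX GX tX].
  have := ge0 zero _ _ isT (gaddE _ zero isT) (gaddE _ zero isT).
  rewrite !outcome_addr0 outcome_leE outcomeL_zero outcomeR_zero.
  by case: (outcomeL G).
rewrite !gaddE // => -[<-] [<-]; rewrite outcome_add0 outcome_leE.
have [RL _ RR] := sum_total_Right_wins G X.
apply/andP; split; apply/implyP; apply: contraTT; [exact: RL | exact: RR].
Qed.

(** Antisymmetry of the componentwise order, applied at each test game, reduces all four relations
    to [game_ge]. *)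
Lemma game_eq_ge G H : game_eq G H <-> game_ge G H /\ game_ge H G.
Proof.
split=> [eqGH|[geGH geHG] X GX HX tX dG dH].
  by split=> X A B tX dA dB; [rewrite (eqGH X A B) | rewrite (eqGH X B A)].
by apply: Order.POrderTheory.le_anti; rewrite (geGH X GX HX) ?(geHG X HX GX).
Qed.

Theorem corollary15 (G : game) :
  (game_gt G zero <-> in_L G) /\
  (game_eq G zero <-> in_P G) /\
  (game_fuzzy G zero <-> in_N G) /\
  (game_lt G zero <-> in_R G).
Proof.
rewrite /game_lt /game_gt /game_fuzzy /in_L /in_P /in_N /in_R /outcome.
(* Every clause becomes propositional in the two booleans [outcomeL G] and [outcomeR G], leaving
   four cases to check. *)
rewrite !game_eq_ge !game_ge0 !game_le0 /is_true.
by case: (outcomeL G) (outcomeR G) => [] [] /=; intuition congruence.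
Qed.
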